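(* Let $m,\hat n,\tilde n\ge 1$ be integers, let $n=\hat n\cdot\tilde n$, and let $A\in\mathbb{R}^{m\times n}$. Suppose that $\hat x\sim\mathcal{N}(0,I_{\hat n})$ and $\tilde x\sim\mathcal{N}(0,I_{\tilde n})$ are independent, and let $\theta>1$. Then the inequality $$\|A\|_2\le\theta\,\|A(\tilde x\otimes\hat x)\|_2$$ holds with probability at least $1-\frac{2}{\pi}\left(2+\ln(1+2\theta)\right)\theta^{-1}$.
   Context: $\otimes$ denotes the Kronecker product, so $\tilde x\otimes\hat x\in\mathbb{R}^n$. $\|\cdot\|_2$ denotes the spectral norm of a matrix and the Euclidean norm of a vector. $\mathcal{N}(0,I_d)$ is the standard Gaussian distribution on $\mathbb{R}^d$. *)

(* Defs.v *)
From HB Require Import structures.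
From mathcomp Require Export all_boot all_order all_algebra.
From mathcomp Require Export all_classical all_reals all_analysis.
From mathcomp Require Export mxtens.

Set Implicit Arguments.
Unset Strict Implicit.
Unset Printing Implicit Defensive.

Import Order.TTheory GRing.Theory Num.Theory.
Local Open Scope classical_set_scope.
Local Open Scope ring_scope.

Definition norm2 (R : realType) (n : nat) (x : 'cV[R]_n) : R :=
  Num.sqrt (\sum_i x i 0 ^+ 2).

(* The spectral norm is the operator norm induced by norm2. *)
Definition spectral_norm (R : realType) (m n : nat) (A : 'M[R]_(m, n)) : R :=
  sup [set norm2 (A *m x) | x in [set x : 'cV[R]_n | norm2 x <= 1]].

(* Random vectors take values in n.-tuple R, whose library sigma-algebra is
   the one generated by the coordinates, i.e. the Borel sigma-algebra of R^n;
   matrices carry no measurable structure. *)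
Definition col_of_tuple (R : realType) (n : nat) (x : n.-tuple R) : 'cV[R]_n :=
  \col_i tnth x i.

Section std_gaussian.
Context (R : realType).

(* normal_prob is a measure on measurableTypeR R, which has the same
   measurable sets as R but another display. *)
Definition tuple_cons (n : nat) (p : measurableTypeR R * n.-tuple R) : n.+1.-tuple R :=
  [tuple of p.1 :: p.2].

Lemma measurable_tuple_cons (n : nat) :
  measurable_fun [set: measurableTypeR R * n.-tuple R] (@tuple_cons n).
Proof. exact: (measurable_cons (T2 := R) measurable_fst measurable_snd). Qed.

HB.instance Definition _ (n : nat) :=
  isMeasurableFun.Build _ _ _ _ (@tuple_cons n) (@measurable_tuple_cons n).

(* N(0, I_n) as the n-fold product of N(0, 1), transported along
   R * R^n = R^(n+1). *)
Fixpoint std_gaussian (n : nat) : probability (n.-tuple R) R :=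
  match n with
  | 0 => dirac [tuple]
  | k.+1 =>
      distribution (normal_prob (0 : R) 1 \x std_gaussian k)%E (@tuple_cons k)
  end.

Lemma std_gaussian_box (n : nat) (B : 'I_n -> set R) :
  (forall i, measurable (B i)) ->
  std_gaussian n [set x | forall i, B i (tnth x i)] =
  (\prod_(i < n) normal_prob (0 : R) 1 (B i))%E.
Proof.
elim: n B => [|n IHn] B mB.
  by rewrite big_ord0 /= diracE mem_set// => -[].
pose box := [set x : n.-tuple R | forall i : 'I_n, B (lift ord0 i) (tnth x i)].
have mbox : measurable box.
  rewrite (_ : box =
      \bigcap_(i in [set: 'I_n]) ((@tnth n R)^~ i @^-1` B (lift ord0 i))).
    apply: fin_bigcap_measurable => //= i _.
    by rewrite -[_ @^-1` _]setTI; exact: measurable_tnth.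
  by apply/seteqP; split=> x h i => [_|]; exact: h.
rewrite big_ord_recl -IHn// -product_measure1E//; last exact: mB.
apply: (congr1 (normal_prob (0 : R) 1 \x std_gaussian n)%E).
apply/seteqP; split=> -[a x] /=.
  move=> h; split=> [|i]; first by have := h ord0.
  by have := h (lift ord0 i); rewrite /tuple_cons tnthS.
move=> [ha hx] i; case: (unliftP ord0 i) => [j|] -> //.
by rewrite /tuple_cons tnthS; exact: hx.
Qed.

End std_gaussian.

Definition has_std_gaussian_distribution (d : measure_display)
    (T : measurableType d) (R : realType) (P : probability T R) (n : nat)
    (X : {RV P >-> n.-tuple R}) : Prop :=
  forall B : set (n.-tuple R), measurable B ->
    distribution P X B = std_gaussian R n B.
Arguments has_std_gaussian_distribution {d T R} P {n} X.

Definition independent_RVs (d d1 d2 : measure_display)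
    (T : measurableType d) (T1 : measurableType d1) (T2 : measurableType d2)
    (R : realType) (P : probability T R)
    (X : {RV P >-> T1}) (Y : {RV P >-> T2}) : Prop :=
  forall (B1 : set T1) (B2 : set T2), measurable B1 -> measurable B2 ->
    P (X @^-1` B1 `&` Y @^-1` B2) = (P (X @^-1` B1) * P (Y @^-1` B2))%E.
Arguments independent_RVs {d d1 d2 T T1 T2 R} P X Y.

(* Main.v *)
Require Import Defs.
From HB Require Import structures.
From mathcomp Require Import all_boot all_order all_algebra.
From mathcomp Require Import all_classical all_reals all_analysis mxtens.
From mathcomp Require Import measurable_realfun ring lra.

(** Let [sigma] be the spectral norm of [A] and [y] the Kronecker product of
    [xtilde] and [xhat]. Up to a factor arbitrarily close to [1], there is a unit
    vector [a] with [sigma * |<a, y>| <= |A y|] (lemma [spectral_norm_approx]), so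
    it suffices to bound the probability of [|<a, y>| < e] with [e] slightly above
    [1 / theta]. The scalar [<a, y>] is the bilinear form [xtilde^T b xhat], where
    [b] is the vector [a] reshaped as a matrix of Frobenius norm [1].

    Given [xhat], this form is a centred normal variable of scale
    [w = |b xhat|], so the conditional probability is at most
    [min 1 (c / w)] with [c = sqrt (2 / pi) * e]. Now [w ^ 2] is a convex
    combination of squares of standard normal variables, one for each row of
    [b], with the squared norms of the rows as weights. As [u |-> c / sqrt u] is
    convex, a tangent line bounds [min 1 (c / w)] by the same convex combination
    of values of [capped_inv c] at these variables ([le_sum_capped_inv]). This
    holds pointwise, whatever the joint law of these variables. Taking
    expectations, the probability is at most the integral of [capped_inv c]
    against the standard normal law ([std_gaussian_bilinear_small_ball]).

    In this integral, bounding [exp (- y ^ 2 / 2)] by [2 / (2 + y ^ 2)] makes the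
    tail elementary and yields
    [e / pi * (3 + ln (1 + pi / e ^ 2))] ([integral_capped_inv_le]). At
    [e = 1 / theta] this is strictly less than the required
    [2 / pi * (2 + ln (1 + 2 * theta)) / theta], since
    [1 + pi * theta ^ 2 <= (1 + 2 * theta) ^ 2]; the difference absorbs the factor
    lost in the first step. *)

Import Order.TTheory GRing.Theory Num.Theory.
Import numFieldNormedType.Exports.
Local Open Scope classical_set_scope.
Local Open Scope ring_scope.

Set Implicit Arguments.
Unset Strict Implicit.
Unset Printing Implicit Defensive.

(** * Integrals against normal laws *)

Section gauss.
Context {R : realType}.
Notation mu := (@lebesgue_measure R).
Notation N01 := (normal_prob (0 : R) 1).
Local Open Scope ereal_scope.

Lemma measurable_affine (s m : R) :
  measurable_fun [set: measurableTypeR R]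
    (fun x : R => s * x + m : measurableTypeR R)%R.
Proof. by apply: measurable_funD => //; apply: measurable_funM. Qed.

(** The Lebesgue measure and [`|s|] times its image under the affine map agree
    on half-open intervals; a negative [s] swaps the closed and the open end,
    hence the two cases. *)
Lemma ge0_integral_affine (s m : R) (f : R -> \bar R) : s != 0%R ->
  measurable_fun [set: R] f -> (forall x, 0 <= f x) ->
  \int[mu]_x f x = `|s|%:E * \int[mu]_x f (s * x + m)%R.
Proof.
move=> s0 mf f0.
have ms := measurable_affine s m.
have k0 : (0 <= `|s|)%R by [].
pose aff := (fun x : measurableTypeR R => s * x + m : measurableTypeR R)%R.
(* the proof that [aff] is measurable is still an argument of [pack_nu] *)
pose pack_nu : {measure set (measurableTypeR R) -> \bar R} :=
  mscale (NngNum k0) (pushforward mu aff).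
pose nu := pack_nu ms.
transitivity (\int[nu]_x f x).
  apply: eq_measure_integral => A mA _.
  apply: (lebesgue_measure_unique (mu := nu)) => // _ [[a b]] _ <-.
  rewrite (_ : nu _ = `|s|%:E * mu (aff @^-1` `]a, b]))//.
  have [sgt|sle] := ltP 0%R s.
    rewrite (_ : aff @^-1` _ = `]((a - m) / s)%R, ((b - m) / s)%R]%classic); last first.
      apply/seteqP; split=> x /=; rewrite !in_itv/=.
        by rewrite ltr_pdivrMr// ler_pdivlMr// (mulrC x) ltrBlDr lerBrDr.
      by rewrite ltr_pdivrMr// ler_pdivlMr// (mulrC x) ltrBlDr lerBrDr.
    rewrite !lebesgue_measure_itv/= !lte_fin ltr_pM2r ?invr_gt0// ltrD2r.
    case: ifPn => // _; last by rewrite mule0.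
    rewrite -!EFinD -EFinM gtr0_norm//; congr EFin; field.
    by rewrite gt_eqF.
  have slt : (s < 0)%R by rewrite lt_neqAle s0.
  rewrite (_ : aff @^-1` _ = `[((b - m) / s)%R, ((a - m) / s)%R[%classic); last first.
    apply/seteqP; split=> x /=; rewrite !in_itv/= andbC;
    by rewrite ltr_ndivlMr// ler_ndivrMr// (mulrC x) ltrBlDr lerBrDr.
  rewrite !lebesgue_measure_itv/= !lte_fin ltr_nM2r ?invr_lt0// ltrD2r.
  case: ifPn => // _; last by rewrite mule0.
  rewrite -!EFinD -EFinM ltr0_norm//; congr EFin; field.
  by rewrite lt_eqF.
rewrite ge0_integral_mscale//=; congr (_ * _).
by rewrite ge0_integral_pushforward.
Qed.

(** [normal_prob] is defined by integrating [normal_pdf] over sets only; the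
    passage to functions goes through the Radon-Nikodym derivative, which is
    almost everywhere the density. *)
Lemma ge0_integral_normal_prob (m s : R) (f : R -> \bar R) :
  measurable_fun [set: R] f -> (forall x, 0 <= f x) ->
  \int[normal_prob m s]_x f x = \int[mu]_x (f x * (normal_pdf m s x)%:E).
Proof.
move=> mf f0.
have dom := normal_prob_dominates m s.
rewrite -(Radon_Nikodym_SigmaFinite.change_of_variables dom)//.
apply: ae_eq_integral => //.
- apply: emeasurable_funM => //.
  exact: measurable_int (Radon_Nikodym_SigmaFinite.f_integrable dom).
- apply: emeasurable_funM => //.
  by apply/measurable_EFinP; exact: measurable_normal_pdf.
- apply: ae_eqe_mul2l; apply: integral_ae_eq => //.
  + exact: Radon_Nikodym_SigmaFinite.f_integrable.
  + by apply/measurable_EFinP; exact: measurable_normal_pdf.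
  + by move=> E _ mE; rewrite -Radon_Nikodym_SigmaFinite.f_integral.
Qed.

Lemma normal_pdf_affine (s m x : R) : s != 0%R ->
  normal_pdf 0 1 x = (`|s| * normal_pdf m s (s * x + m))%R.
Proof.
move=> s0; rewrite !normal_pdfE ?oner_eq0// /normal_peak /normal_fun.
have -> : (Num.sqrt (s ^+ 2 * pi *+ 2) = `|s| * Num.sqrt (1 ^+ 2 * pi *+ 2))%R.
  by rewrite expr1n mul1r -mulrnAr sqrtrM ?sqr_ge0// sqrtr_sqr.
rewrite mulrA invfM mulrA divff ?normr_eq0// mul1r; congr (_ * expR _)%R.
by field.
Qed.

Lemma normal_pdfN (m s x : R) : normal_pdf m (- s) x = normal_pdf m s x.
Proof. by rewrite /normal_pdf oppr_eq0 /normal_peak /normal_fun sqrrN. Qed.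

Lemma ge0_integral_normal_affine (s m : R) (f : R -> \bar R) : s != 0%R ->
  measurable_fun [set: R] f -> (forall x, 0 <= f x) ->
  \int[N01]_x f (s * x + m)%R = \int[normal_prob m s]_x f x.
Proof.
move=> s0 mf f0.
have mfa : measurable_fun [set: R] (fun x => f (s * x + m)%R).
  exact: measurableT_comp mf (measurable_affine s m).
rewrite (ge0_integral_normal_prob m s mf f0).
rewrite (ge0_integral_normal_prob 0 1 mfa (fun x => f0 _)).
rewrite [RHS](@ge0_integral_affine s m)//; last 2 first.
- apply: emeasurable_funM => //.
  by apply/measurable_EFinP; exact: measurable_normal_pdf.
- by move=> x; rewrite mule_ge0// lee_fin normal_pdf_ge0.
rewrite -ge0_integralZl//.
- apply: eq_integral => x _.
  by rewrite (@normal_pdf_affine s m)//= EFinM muleCA.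
- apply: (measurableT_comp (f := fun x => f x * (normal_pdf m s x)%:E)).
    apply: emeasurable_funM => //.
    by apply/measurable_EFinP; exact: measurable_normal_pdf.
  exact: measurable_affine.
- by move=> x _; rewrite mule_ge0// lee_fin normal_pdf_ge0.
Qed.

Lemma ge0_integral_normal_scale (s : R) (f : R -> \bar R) : s != 0%R ->
  measurable_fun [set: R] f -> (forall x, 0 <= f x) ->
  \int[N01]_x f (s * x)%R = \int[normal_prob 0 s]_x f x.
Proof.
move=> s0 mf f0; rewrite -(ge0_integral_normal_affine 0 s0 mf f0).
by apply: eq_integral => x _; rewrite addr0.
Qed.

(** The normal density depends on its scale through the square only. *)
Lemma ge0_integral_normalN (s : R) (f : R -> \bar R) :
  measurable_fun [set: R] f -> (forall x, 0 <= f x) ->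
  \int[N01]_x f (- s * x)%R = \int[N01]_x f (s * x)%R.
Proof.
move=> mf f0; have [->|s0] := eqVneq s 0%R; first by rewrite oppr0.
have Ns0 : (- s != 0)%R by rewrite oppr_eq0.
rewrite (ge0_integral_normal_scale Ns0 mf f0) (ge0_integral_normal_scale s0 mf f0).
rewrite (ge0_integral_normal_prob 0 (- s) mf f0).
rewrite (ge0_integral_normal_prob 0 s mf f0).
by apply: eq_integral => x _; rewrite normal_pdfN.
Qed.

(** The joint density of [(p X + q Y, Y)], for independent standard normal [X]
    and [Y], factored in two ways: the law of the first coordinate given the
    second, and, by completing the square in [y], the law of the second given
    the first. The latter factorization shows that [p X + q Y] has scale [r]. *)
Lemma normal_pdf_convolve (p q r x y : R) :
  p != 0%R -> r != 0%R -> (r ^+ 2 = p ^+ 2 + q ^+ 2)%R ->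
  (normal_pdf (q * y) p x * normal_pdf 0 1 y =
   normal_pdf 0 r x * normal_pdf (q * x / r ^+ 2) (p / r) y)%R.
Proof.
move=> p0 r0 rpq.
have pr0 : (p / r != 0)%R by rewrite mulf_neq0// invr_eq0.
have peakE (s : R) : normal_peak s = (`|s|^-1 * normal_peak 1)%R.
  rewrite /normal_peak -invfM expr1n mul1r.
  by rewrite -mulrnAr sqrtrM ?sqr_ge0// sqrtr_sqr.
rewrite !normal_pdfE ?oner_eq0// [normal_peak p]peakE [normal_peak r]peakE.
rewrite [normal_peak (p / r)]peakE normrM normrV ?unitfE// /normal_fun.
rewrite mulrACA [RHS]mulrACA -!expRD; congr (_ * expR _)%R.
  field.
  by rewrite !normr_eq0 r0 p0.
have q2 : (q ^+ 2 = r ^+ 2 - p ^+ 2)%R by rewrite rpq addrC addKr.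
field : q2.
by rewrite p0 r0.
Qed.

End gauss.

(** * Linear forms on Gaussian vectors *)

Section linear.
Context {R : realType}.
Notation mu := (@lebesgue_measure R).
Notation N01 := (normal_prob (0 : R) 1).
Local Open Scope ereal_scope.

Lemma measurable_normal_pdf_convolve (p q : R) : p != 0%R ->
  measurable_fun [set: measurableTypeR R * measurableTypeR R]
    (fun z => normal_pdf (q * z.2) p z.1).
Proof.
move=> p0; rewrite (_ : (fun z => _) =
    fun z : measurableTypeR R * measurableTypeR R =>
      normal_pdf 0 p (z.1 - q * z.2)%R); last first.
  by apply/funext=> z; rewrite !normal_pdfE// /normal_fun subr0.
apply: (measurableT_comp (measurable_normal_pdf 0 p)).
apply: measurable_funB; first exact: measurable_fst.
by apply: measurable_funM => //; exact: measurable_snd.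
Qed.

(** A linear combination of two independent standard normal variables is normal
    with the Euclidean norm of the coefficients as scale: by Tonelli and
    [normal_pdf_convolve], the variable [y] integrates out to [1]. The density
    argument needs [p != 0]; when [p = 0] only the sign of [q] matters. *)
Lemma ge0_integral_normal_pair (p q : R) (f : R -> \bar R) :
  measurable_fun [set: R] f -> (forall x, 0 <= f x) ->
  \int[N01]_y \int[N01]_x f (p * x + q * y)%R =
  \int[N01]_x f (Num.sqrt (p ^+ 2 + q ^+ 2) * x)%R.
Proof.
move=> mf f0; have [->|p0] := eqVneq p 0%R.
  transitivity (\int[N01]_y f (q * y)%R).
    apply: eq_integral => y _.
    rewrite -[RHS](_ : \int[N01]_x (cst (f (q * y)%R) x) = _).
      by apply: eq_integral => x _; rewrite mul0r add0r.
    by rewrite integral_cst//= probability_setT mule1.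
  rewrite expr0n add0r sqrtr_sqr.
  have [q0|q0] := ger0P q => //.
  by rewrite -(ge0_integral_normalN (- q) mf f0) opprK.
set r := Num.sqrt _.
have r2 : (r ^+ 2 = p ^+ 2 + q ^+ 2)%R by rewrite sqr_sqrtr// addr_ge0// sqr_ge0.
have r0 : r != 0%R.
  rewrite -sqrf_eq0 r2 gt_eqF// ltr_wpDr ?sqr_ge0//.
  by rewrite exprn_even_gt0.
pose h (z : measurableTypeR R * measurableTypeR R) :=
  f z.1 * (normal_pdf (q * z.2) p z.1)%:E * (normal_pdf 0 1 z.2)%:E.
have h0 z : 0 <= h z.
  by rewrite !mule_ge0// lee_fin normal_pdf_ge0.
have mpdf (m s : R) : measurable_fun [set: R] (fun x => (normal_pdf m s x)%:E).
  by apply/measurable_EFinP; exact: measurable_normal_pdf.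
have mh : measurable_fun setT h.
  apply: emeasurable_funM; last first.
    exact: measurableT_comp (mpdf 0 1)%R measurable_snd.
  apply: emeasurable_funM; first exact: measurableT_comp mf measurable_fst.
  by apply/measurable_EFinP; exact: measurable_normal_pdf_convolve.
have hint y : \int[N01]_x f (p * x + q * y)%R =
    \int[mu]_x (f x * (normal_pdf (q * y) p x)%:E).
  by rewrite (ge0_integral_normal_affine (q * y) p0 mf f0)
    (ge0_integral_normal_prob (q * y) p mf f0).
have fpdf0 y x : 0 <= f x * (normal_pdf (q * y) p x)%:E.
  by rewrite mule_ge0// lee_fin normal_pdf_ge0.
have mfpdf y : measurable_fun [set: R] (fun x => f x * (normal_pdf (q * y) p x)%:E).
  exact: emeasurable_funM.
transitivity (\int[mu]_y \int[mu]_x h (x, y)).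
  under eq_integral do rewrite hint.
  rewrite ge0_integral_normal_prob; last 2 first.
  - apply: (measurable_fun_fubini_tonelli_G (m1 := mu)
      (fun z : measurableTypeR R * measurableTypeR R =>
         f z.1 * (normal_pdf (q * z.2) p z.1)%:E)) => [|z].
      apply: emeasurable_funM; first exact: measurableT_comp mf measurable_fst.
      by apply/measurable_EFinP; exact: measurable_normal_pdf_convolve.
    by rewrite mule_ge0// lee_fin normal_pdf_ge0.
  - by move=> y; exact: integral_ge0.
  apply: eq_integral => y _; rewrite -ge0_integralZr//; last first.
    by rewrite lee_fin normal_pdf_ge0.
  exact: mfpdf.
transitivity (\int[mu]_x \int[mu]_y h (x, y)).
  exact/esym/(fubini_tonelli (m1 := mu) (m2 := mu) h mh h0).
rewrite (ge0_integral_normal_scale r0 mf f0) (ge0_integral_normal_prob 0 r mf f0).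
apply: eq_integral => x _.
transitivity (\int[mu]_y (f x * (normal_pdf 0 r x)%:E *
    (normal_pdf (q * x / r ^+ 2) (p / r) y)%:E)); last first.
  rewrite ge0_integralZl//.
  + by rewrite integral_normal_pdf mule1.
  + exact: mpdf.
  + by move=> y _; rewrite lee_fin normal_pdf_ge0.
  + by rewrite mule_ge0// lee_fin normal_pdf_ge0.
apply: eq_integral => y _; rewrite /h/= -!muleA -!EFinM.
by rewrite (normal_pdf_convolve x y p0 r0 r2).
Qed.

Lemma measurable_lincomb n (a : 'I_n -> R) :
  measurable_fun [set: n.-tuple R] (fun x => \sum_i a i * tnth x i)%R.
Proof.
apply: measurable_sum => i; apply: measurable_funM => //.
exact: measurable_tnth.
Qed.

(** A linear form on a standard Gaussian vector is distributed as its norm times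
    a standard normal variable. Stated with integrals of nonnegative functions,
    it goes through the recursive definition of [std_gaussian] by Tonelli, one
    coordinate at a time. *)
Lemma ge0_integral_gaussian_lincomb n (a : 'I_n -> R) (f : R -> \bar R) :
  measurable_fun [set: R] f -> (forall x, 0 <= f x) ->
  \int[std_gaussian R n]_x f (\sum_i a i * tnth x i)%R =
  \int[N01]_y f (Num.sqrt (\sum_i a i ^+ 2) * y)%R.
Proof.
elim: n a f => [|n IHn] a f mf f0.
  rewrite integral_dirac//; last exact: measurableT_comp (measurable_lincomb a).
  rewrite diracT mul1e !big_ord0 sqrtr0.
  under eq_integral do rewrite mul0r.
  by rewrite integral_cst//= probability_setT mule1.
pose b i := a (lift ord0 i).
have mshift (c : R) : measurable_fun [set: R] (fun t : R => f (c + t)%R).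
  by apply: (measurableT_comp mf); exact: measurable_funD.
rewrite ge0_integral_distribution//; last exact: measurableT_comp (measurable_lincomb a).
pose g (z : measurableTypeR R * n.-tuple R) :=
  f (a ord0 * z.1 + \sum_i b i * tnth z.2 i)%R.
have mg : measurable_fun setT g.
  apply: (measurableT_comp mf); apply: measurable_funD.
    by apply: measurable_funM => //; exact: measurable_fst.
  exact: measurableT_comp (measurable_lincomb b) measurable_snd.
transitivity (\int[normal_prob (0 : R) 1 \x std_gaussian R n]_z g z).
  apply: eq_integral => -[u x] _; rewrite /g/= big_ord_recl/=.
  congr (f (_ + _)%R); apply: eq_bigr => i _; congr (_ * _)%R.
  by rewrite /tuple_cons tnthS.
rewrite (fubini_tonelli1 g mg (fun z => f0 _)).
transitivity (\int[N01]_x \int[N01]_y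
    f (a ord0 * x + Num.sqrt (\sum_i b i ^+ 2) * y)%R).
  apply: eq_integral => x _.
  exact: (IHn b (fun t => f (a ord0 * x + t)%R) (mshift _) (fun t => f0 _)).
set t := Num.sqrt _.
under eq_integral => x _ do under eq_integral => y _ do rewrite addrC.
rewrite (ge0_integral_normal_pair _ _ mf f0).
rewrite sqr_sqrtr; last by apply: sumr_ge0 => i _; exact: sqr_ge0.
by rewrite big_ord_recl addrC.
Qed.

End linear.

(** * A convexity bound for small-ball probabilities *)

Section capped.
Context {R : realType}.
Notation mu := (@lebesgue_measure R).
Notation N01 := (normal_prob (0 : R) 1).

(** On its support this is [c / y]; the denominator [Num.max c y] keeps the
    quotient continuous on the whole line, hence measurable. *)
Definition cut_inv (c y : R) : R := if c <= y then c / Num.max c y else 0.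

(** A majorant of every tangent function used in [le_sum_capped_inv]: [3 / 2] near
    the origin and [c / |y|] away from it. *)
Definition capped_inv (c y : R) : R :=
  if `|y| <= c then 3 / 2 else cut_inv c `|y|.

Lemma cut_inv_ge0 (c y : R) : 0 < c -> 0 <= cut_inv c y.
Proof.
move=> c0; rewrite /cut_inv; case: ifP => // _.
by rewrite divr_ge0 ?(ltW c0)// le_max (ltW c0).
Qed.

Lemma capped_inv_ge0 (c y : R) : 0 < c -> 0 <= capped_inv c y.
Proof.
move=> c0; rewrite /capped_inv; case: ifP => // _; exact: cut_inv_ge0.
Qed.

Lemma measurable_cut_inv (c : R) : 0 < c -> measurable_fun [set: R] (cut_inv c).
Proof.
move=> c0; apply: measurable_fun_ifT => //.
  by apply: measurable_fun_ler.
apply: measurable_funM => //; apply: continuous_measurable_fun => x.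
apply: cvgV; first by rewrite gt_eqF// lt_max c0.
by apply: continuous_max; [exact: cvg_cst|exact: cvg_id].
Qed.

Lemma measurable_capped_inv (c : R) : 0 < c ->
  measurable_fun [set: R] (capped_inv c).
Proof.
move=> c0; apply: measurable_fun_ifT => //.
  by apply: measurable_fun_ler => //; exact: normr_measurable.
apply: (measurableT_comp (measurable_cut_inv c0)); exact: normr_measurable.
Qed.

(** A Jensen inequality. The function [u |-> c / sqrt u] is convex; with
    [s = max w c], its tangent at [s ^ 2] is
    [T u = c / (2 * s ^ 3) * (3 * s ^ 2 - u)]. Being affine, [T] commutes with the
    weighted average defining [w ^ 2]. At [w ^ 2] it is at least [min 1 (c / w)],
    hence at least [p]; at [h ^ 2] it is at most [3 / 2] because [c <= s], and at
    most [c / |h|] because it is a tangent. *)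
Lemma le_sum_capped_inv n (c p w : R) (l h : 'I_n -> R) :
  0 < c -> 0 <= w -> p <= 1 -> p * w <= c ->
  (forall i, 0 <= l i) -> \sum_i l i = 1 -> w ^+ 2 = \sum_i l i * h i ^+ 2 ->
  p <= \sum_i l i * capped_inv c (h i).
Proof.
move=> c0 w0 p1 pw l0 l1 w2.
pose s := Num.max w c.
have s0 : 0 < s by rewrite lt_max c0 orbT.
have ws : w <= s by rewrite le_max lexx.
have cs : c <= s by rewrite le_max lexx orbT.
pose T u := c / (2 * s ^+ 3) * (3 * s ^+ 2 - u).
have k0 : 0 < c / (2 * s ^+ 3) by rewrite divr_gt0// mulr_gt0// exprn_gt0.
apply: (@le_trans _ _ (T (w ^+ 2))).
  rewrite /T mulrAC ler_pdivlMr ?mulr_gt0 ?exprn_gt0//.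
  rewrite /s; have [wc|cw] := leP w c.
    have h1 : p * (2 * c ^+ 3) <= 2 * c ^+ 3.
      by rewrite ler_piMl// mulr_ge0// exprn_ge0// ltW.
    have h2 : 0 <= c * (c ^+ 2 - w ^+ 2).
      by rewrite mulr_ge0 ?(ltW c0)// subr_ge0 ler_sqr ?nnegrE// ltW.
    nra.
  have -> : p * (2 * w ^+ 3) = p * w * (2 * w ^+ 2) by ring.
  have -> : c * (3 * w ^+ 2 - w ^+ 2) = c * (2 * w ^+ 2) by ring.
  by rewrite ler_wpM2r// mulr_ge0// sqr_ge0.
have -> : T (w ^+ 2) = \sum_i l i * T (h i ^+ 2).
  rewrite /T w2 -[X in _ * (X - _)]mulr1 -l1 mulr_sumr -sumrB mulr_sumr.
  by apply: eq_bigr => i _; ring.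
apply: ler_sum => i _; apply: ler_wpM2l => //.
(* the value of the tangent at the origin is [3 / 2 * (c / s)] *)
have T1 : T (h i ^+ 2) <= 3 / 2.
  apply: (@le_trans _ _ (c / (2 * s ^+ 3) * (3 * s ^+ 2))).
    by rewrite ler_wpM2l ?(ltW k0)// lerBlDr lerDl sqr_ge0.
  have -> : c / (2 * s ^+ 3) * (3 * s ^+ 2) = 3 / 2 * (c / s).
    by field; rewrite gt_eqF.
  by rewrite ler_piMr// ?ler_pdivrMr// ?mul1r//; lra.
rewrite /capped_inv; have [//|hc] := leP `|h i| c.
rewrite /cut_inv (ltW hc) (max_idPr (ltW hc)).
have a0 : 0 < `|h i| by rewrite (lt_trans c0).
rewrite -[h i ^+ 2]real_normK ?num_real// /T ler_pdivlMr//.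
(* convexity of [c / sqrt u], made algebraic: [2 s^3 - 3 s^2 u + u^3] has [s] as
   a double root *)
set u := `|h i| in a0 *.
have -> : c / (2 * s ^+ 3) * (3 * s ^+ 2 - u ^+ 2) * u =
    c / (2 * s ^+ 3) * (2 * s ^+ 3 - (s - u) ^+ 2 * (2 * s + u)) by ring.
rewrite mulrBr divfK; last by rewrite gt_eqF// mulr_gt0// exprn_gt0.
rewrite lerBlDr lerDl; apply: mulr_ge0; first exact: ltW.
by rewrite mulr_ge0 ?sqr_ge0//; lra.
Qed.

End capped.

(** * The Gaussian integral of the convexity bound *)

Section tail.
Context {R : realType}.
Notation mu := (@lebesgue_measure R).
Notation N01 := (normal_prob (0 : R) 1).
Notation peak := (normal_peak (1 : R)).

(** From [1 + t <= expR t] at [t = x ^ 2 / 2]. The point of this rational bound is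
    that its product with [1 / x] has an elementary primitive, and that the loss
    does not affect the leading logarithm. *)
Lemma normal_pdf_le_cauchy (x : R) : normal_pdf 0 1 x <= peak * (2 / (2 + x ^+ 2)).
Proof.
rewrite normal_pdfE ?oner_eq0// ler_wpM2l ?normal_peak_ge0//.
have x2 : 0 < 2 + x ^+ 2 by rewrite ltr_pwDl// sqr_ge0.
rewrite /normal_fun subr0 expr1n mulNr expRN.
rewrite -[leRHS]invrK lef_pV2 ?posrE ?expR_gt0 ?invr_gt0 ?divr_gt0//.
apply: le_trans (expR_ge1Dx _).
by rewrite invf_div le_eqVlt; apply/orP; left; apply/eqP; field.
Qed.

Lemma normal_prob_symitv_le (t : R) : 0 <= t ->
  (N01 `[(- t)%R, t] <= (2 * peak * t)%:E)%E.
Proof.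
move=> t0; rewrite /normal_prob.
apply: (@le_trans _ _ (\int[mu]_(x in `[(- t)%R, t]) peak%:E)%E).
  apply: ge0_le_integral => //.
  - by move=> x _; rewrite lee_fin normal_pdf_ge0.
  - by apply/measurable_funTS/measurable_EFinP; exact: measurable_normal_pdf.
  - by move=> x _; rewrite lee_fin normal_pdf_ub ?oner_eq0.
rewrite integral_cst//= lebesgue_measure_itv/= lte_fin.
case: ifP => _; last by rewrite mule0 lee_fin !mulr_ge0 ?normal_peak_ge0.
by rewrite -EFinD -EFinM lee_fin; lra.
Qed.

(** The primitive of [2 / (y * (2 + y ^ 2))] that vanishes at infinity. *)
Let logtail (y : R) : R := - (ln (1 + 2 * y^-1 ^+ 2) / 2).

Let is_derive_logtail (y : R) : 0 < y ->
  is_derive y 1 logtail (2 / (y * (2 + y ^+ 2))).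
Proof.
move=> y0.
have y2 : 0 < 1 + 2 * y^-1 ^+ 2.
  by rewrite ltr_pwDl// mulr_ge0// sqr_ge0.
have yn0 : y != 0 by rewrite gt_eqF.
have dln := is_derive1_ln y2.
have dV := @is_deriveV _ id _ _ _ yn0 (is_derive_id y 1).
have dX : is_derive y 1 (fun z : R => 1 + 2 * z^-1 ^+ 2) _ :=
  is_deriveD (is_derive_cst (1 : R) y 1) (is_deriveZ 2 (is_deriveX 2 dV)).
have dc := is_derive1_comp (f := @ln R)
  (g := fun z : R => 1 + 2 * z^-1 ^+ 2) dln dX.
have := is_deriveN (is_deriveZ 2^-1 dc).
rewrite (_ : - (2^-1 \*: _) = logtail); last first.
  by apply/funext => z /=; rewrite /logtail mulrC.
move=> dl; apply: (is_derive_eq dl); rewrite /GRing.scale/= expr1; field.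
by rewrite yn0 andbT gt_eqF// ltr_pwDl// sqr_ge0.
Qed.

Let continuous_tail (c : R) : 0 < c ->
  {within `[c, +oo[, continuous (fun y : R => 2 / (y * (2 + y ^+ 2)))}.
Proof.
move=> c0; apply: continuous_in_subspaceT => y /[!inE]/= /[!in_itv]/= /[!andbT] cy.
have y0 : 0 < y by rewrite (lt_le_trans c0).
apply: cvgM; first exact: cvg_cst.
apply: cvgV.
  by rewrite gt_eqF// mulr_gt0// ltr_pwDl// sqr_ge0.
apply: cvgM; first exact: cvg_id.
apply: cvgD; first exact: cvg_cst.
exact: exprn_continuous.
Qed.

Let logtail_cvg : logtail y @[y --> +oo] --> (0 : R).
Proof.
have cvg1 : (1 + 2 * y^-1 ^+ 2 : R) @[y --> +oo] --> (1 : R).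
  have V0 : (y^-1 : R) @[y --> +oo] --> (0 : R).
    apply/gtr0_cvgV0; last exact: cvg_id.
    exact: nbhs_pinfty_gt.
  have := cvgD (cvg_cst (1 : R)) (cvgM (cvg_cst (2 : R)) (cvgM V0 V0)).
  by rewrite !mulr0 addr0 => h; exact: h.
have cvgln := continuous_cvg _ (continuous_ln ltr01) cvg1.
have := cvgN (cvgM (cvgln _) (cvg_cst (2^-1 : R))).
by rewrite ln1 mul0r oppr0 => h; exact: h.
Qed.

Lemma integral_tail (c : R) : 0 < c ->
  (\int[mu]_(y in `[c, +oo[) (2 / (y * (2 + y ^+ 2)))%:E =
   (ln (1 + 2 / c ^+ 2) / 2)%:E)%E.
Proof.
move=> c0; rewrite (@ge0_continuous_FTC2y _ _ logtail _ 0).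
- by rewrite sub0e -EFinN opprK exprVn.
- move=> y cy; have y0 : 0 < y by rewrite (lt_le_trans c0).
  by rewrite divr_ge0// mulr_ge0 ?(ltW y0)// addr_ge0// sqr_ge0.
- exact: continuous_tail.
- exact: logtail_cvg.
- by move=> y cy; have [] := is_derive_logtail (lt_trans c0 cy).
- apply: cvg_at_right_filter; have [d _] := is_derive_logtail c0.
  by apply: differentiable_continuous; exact/derivable1_diffP.
- move=> y; rewrite in_itv/= andbT => cy; rewrite derive1E.
  by have [] := is_derive_logtail (lt_trans c0 cy).
Qed.

Lemma integral_cut_inv_le (c : R) : 0 < c ->
  (\int[N01]_y (cut_inv c y)%:E <= (peak * c * (ln (1 + 2 / c ^+ 2) / 2))%:E)%E.
Proof.
move=> c0.
have mg : measurable_fun [set: R] (fun y => (cut_inv c y)%:E).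
  by apply/measurable_EFinP; exact: measurable_cut_inv.
have g0 y : (0 <= (cut_inv c y)%:E)%E by rewrite lee_fin cut_inv_ge0.
rewrite (ge0_integral_normal_prob 0 1 mg g0).
apply: (@le_trans _ _ (\int[mu]_(y in `[c, +oo[)
    ((peak * c)%:E * (2 / (y * (2 + y ^+ 2)))%:E))%E); last first.
  rewrite ge0_integralZl_EFin//.
  + by rewrite integral_tail.
  + move=> y /=; rewrite in_itv/= andbT => cy.
    have y0 : 0 < y by rewrite (lt_le_trans c0).
    by rewrite lee_fin divr_ge0// mulr_ge0 ?(ltW y0)// addr_ge0// sqr_ge0.
  + apply/measurable_EFinP; apply: subspace_continuous_measurable_fun => //.
    exact: continuous_tail.
  + by rewrite mulr_ge0 ?normal_peak_ge0// ltW.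
rewrite [leRHS]integral_mkcond; apply: ge0_le_integral => //.
- by move=> y _; rewrite mule_ge0// lee_fin normal_pdf_ge0.
- apply: emeasurable_funM => //.
  by apply/measurable_EFinP; exact: measurable_normal_pdf.
- apply/(measurable_restrictT _ _).1 => //.
  apply: emeasurable_funM => //; apply/measurable_EFinP.
  apply: subspace_continuous_measurable_fun => //.
  exact: continuous_tail.
- move=> y _; rewrite patchE mem_setE in_itv/= andbT /cut_inv.
  have [cy|_] := leP c y; last by rewrite mul0e.
  have y0 : 0 < y by rewrite (lt_le_trans c0).
  rewrite -!EFinM lee_fin.
  have -> : peak * c * (2 / (y * (2 + y ^+ 2))) =
      c / y * (peak * (2 / (2 + y ^+ 2))).
    field; rewrite (gt_eqF y0) andbT gt_eqF//.
    by rewrite ltr_pwDl// sqr_ge0.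
  by rewrite ler_wpM2l ?normal_pdf_le_cauchy// divr_ge0 ?(ltW c0)// ltW.
Qed.

(** The two tails contribute equally by symmetry, and the cap contributes
    [3 / 2] times the mass of [[-c, c]]. *)
Lemma integral_capped_inv_le (c : R) : 0 < c ->
  (\int[N01]_y (capped_inv c y)%:E <=
   (peak * c * (3 + ln (1 + 2 / c ^+ 2)))%:E)%E.
Proof.
move=> c0.
have mg : measurable_fun [set: R] (fun y => (cut_inv c y)%:E).
  by apply/measurable_EFinP; exact: measurable_cut_inv.
have g0 y : (0 <= (cut_inv c y)%:E)%E by rewrite lee_fin cut_inv_ge0.
have mgN : measurable_fun [set: R] (fun y => (cut_inv c (- y))%:E).
  by apply: (measurableT_comp mg).
have mind : measurable_fun [set: R]
    (fun y : R => (3 / 2 : R)%:E * (\1_`[(- c)%R, c] y)%:E)%E.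
  by apply: measurable_funeM; apply/measurable_EFinP; exact: measurable_indic.
have ind0 (y : R) : (0 <= (3 / 2 : R)%:E * (\1_`[(- c)%R, c] y : R)%:E)%E.
  by rewrite mule_ge0// lee_fin.
apply: (@le_trans _ _ (\int[N01]_y ((3 / 2 : R)%:E * (\1_`[(- c)%R, c] y)%:E +
    ((cut_inv c y)%:E + (cut_inv c (- y))%:E)))%E).
  apply: ge0_le_integral => //.
  - by move=> y _; rewrite lee_fin capped_inv_ge0.
  - by apply/measurable_EFinP; exact: measurable_capped_inv.
  - by apply: emeasurable_funD => //; exact: emeasurable_funD.
  - move=> y _; rewrite -EFinM -!EFinD lee_fin /capped_inv.
    have u0 := cut_inv_ge0 y c0; have v0 := cut_inv_ge0 (- y) c0.
    have i0 : 0 <= \1_`[(- c)%R, c] y :> R by [].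
    case: ifPn => yc.
      rewrite (_ : \1_`[(- c)%R, c] y = 1) ?mulr1 ?lerDl ?addr_ge0//.
      by rewrite indicE mem_set//= in_itv/= -ler_norml.
    by have [?|?] := ger0P y; lra.
rewrite ge0_integralD//; last 2 first.
- by move=> y _; exact: adde_ge0.
- exact: emeasurable_funD.
rewrite ge0_integralD// ge0_integralZl_EFin//; last first.
  by apply/measurable_EFinP; exact: measurable_indic.
rewrite integral_indic// setIT.
have -> : (\int[N01]_y (cut_inv c (- y))%:E = \int[N01]_y (cut_inv c y)%:E)%E.
  transitivity (\int[N01]_y (cut_inv c (- 1 * y))%:E)%E.
    by apply: eq_integral => y _; rewrite mulN1r.
  rewrite (ge0_integral_normalN 1 mg g0).
  by apply: eq_integral => y _; rewrite mul1r.
have I := integral_cut_inv_le c0.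
apply: (@le_trans _ _ ((3 / 2 : R)%:E * (2 * peak * c)%:E +
  ((peak * c * (ln (1 + 2 / c ^+ 2) / 2))%:E +
   (peak * c * (ln (1 + 2 / c ^+ 2) / 2))%:E))%E).
  apply: leeD; last exact: leeD.
  by rewrite lee_wpmul2l// ?lee_fin// normal_prob_symitv_le// ltW.
by rewrite -EFinM -!EFinD lee_fin; lra.
Qed.

End tail.

(** * Small balls for bilinear forms *)

Section smallball.
Context {R : realType}.
Notation N01 := (normal_prob (0 : R) 1).
Notation peak := (normal_peak (1 : R)).

Lemma measurable_abs_lt d (T : measurableType d) (g : T -> R) (e : R) :
  measurable_fun [set: T] g -> measurable [set x | `|g x| < e].
Proof.
move=> mg.
have m : measurable_fun [set: T] (fun x => `|g x|).
  exact: measurableT_comp (@normr_measurable R setT) mg.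
have := m measurableT _ (measurable_itv `]-oo, e[); rewrite setTI.
by congr measurable; apply/seteqP; split => x /=; rewrite in_itv.
Qed.

(** Stated as a product so that [w = 0] is allowed, as required by
    [le_sum_capped_inv]. *)
Lemma normal_small_ball (w e : R) : 0 <= w -> 0 <= e ->
  (N01 [set y | (`|w * y| < e)%R] * w%:E <= (2 * peak * e)%:E)%E.
Proof.
rewrite le_eqVlt => /predU1P[<-|w0] e0.
  by rewrite mule0 lee_fin !mulr_ge0// normal_peak_ge0.
rewrite -lee_pdivlMr// -EFinM -(mulrA (2 * peak)).
apply: le_trans (normal_prob_symitv_le _); last by rewrite divr_ge0// ltW.
apply: le_measure; rewrite ?inE//.
- by apply: measurable_abs_lt; apply: measurable_funM.
- move=> y /=; rewrite in_itv/= -ler_norml normrM (gtr0_norm w0) => wy.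
  by rewrite ler_pdivlMr// mulrC ltW.
Qed.

Lemma std_gaussian_lincomb_abs_lt n (a : 'I_n -> R) (e : R) :
  std_gaussian R n [set x | `|\sum_i a i * tnth x i| < e] =
  N01 [set y | `|Num.sqrt (\sum_i a i ^+ 2) * y| < e].
Proof.
pose B : set R := [set t | `|t| < e].
have mB : measurable B by apply: measurable_abs_lt.
pose f (t : R) : \bar R := (\1_B t)%:E.
have mf : measurable_fun [set: R] f.
  by apply/measurable_EFinP; exact: measurable_indic.
have f0 t : (0 <= f t)%E by rewrite lee_fin.
have := ge0_integral_gaussian_lincomb a mf f0.
rewrite (_ : (fun x => f _) =
  fun x => (\1_[set x : n.-tuple R | `|\sum_i a i * tnth x i| < e] x)%:E); last first.
  by apply/funext => x; rewrite /f !indicE.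
rewrite integral_indic ?setIT//; last first.
  by apply: measurable_abs_lt; exact: measurable_lincomb.
move=> ->.
rewrite (_ : (fun y => f _) =
  fun y => (\1_[set y : measurableTypeR R |
      `|Num.sqrt (\sum_i a i ^+ 2) * y| < e] y)%:E); last first.
  by apply/funext => x; rewrite /f !indicE.
rewrite integral_indic ?setIT//.
by apply: measurable_abs_lt; apply: measurable_funM.
Qed.

Lemma measurable_bilinear (p q : nat) (b : 'I_p -> 'I_q -> R) :
  measurable_fun [set: q.-tuple R * p.-tuple R]
    (fun z => \sum_i (\sum_j b i j * tnth z.1 j) * tnth z.2 i).
Proof.
apply: measurable_sum => i; apply: measurable_funM.
  exact: (measurableT_comp (measurable_lincomb _) measurable_fst).
exact: (measurableT_comp (measurable_tnth _) measurable_snd).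
Qed.

(** Given the first vector [x], the form is a centred normal variable of scale
    [w = |b x|], and [w ^ 2] is the sum of the squares of the coordinates of
    [b x]. With [l i] the squared norm of the [i]-th row of [b], these are [l i]
    times squares of standard normal variables, and the [l i] sum to [1]. So
    [le_sum_capped_inv] bounds the conditional probability by a weighted average of
    quantities having all the same expectation. *)
Lemma std_gaussian_bilinear_small_ball (p q : nat) (b : 'I_p -> 'I_q -> R) (e c : R) :
  \sum_i \sum_j b i j ^+ 2 = 1 -> 0 < e -> c = 2 * peak * e ->
  ((std_gaussian R q \x std_gaussian R p)
    [set z | (`|\sum_i (\sum_j b i j * tnth z.1 j) * tnth z.2 i| < e)%R] <=
   (peak * c * (3 + ln (1 + 2 / c ^+ 2)))%:E)%E.
Proof.
move=> b1 e0 cE.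
have c0 : 0 < c by rewrite cE !mulr_gt0// normal_peak_gt0 ?oner_eq0.
set S := [set z | _]; set B := peak * c * _.
pose a (x : q.-tuple R) i := \sum_j b i j * tnth x j.
pose l i := \sum_j b i j ^+ 2.
have l0 i : 0 <= l i by apply: sumr_ge0 => j _; exact: sqr_ge0.
pose g i j := b i j / Num.sqrt (l i).
(* for a zero row both sides vanish, whatever the value of [0 / 0] *)
have ha x i : a x i ^+ 2 = l i * (\sum_j g i j * tnth x j) ^+ 2.
  rewrite (_ : \sum_j g i j * tnth x j = a x i / Num.sqrt (l i)); last first.
    by rewrite /a mulr_suml; apply: eq_bigr => j _; rewrite /g mulrAC.
  rewrite exprMn exprVn sqr_sqrtr//; have [li|li] := eqVneq (l i) 0.
    rewrite li mul0r /a big1 ?expr0n// => j _.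
    have /eqP := li; rewrite psumr_eq0; last by move=> k _; exact: sqr_ge0.
    by move=> /allP/(_ j); rewrite mem_index_enum sqrf_eq0 => /(_ isT)/eqP->; rewrite mul0r.
  by rewrite mulrC divfK.
have mS : measurable S.
  by apply: measurable_abs_lt; exact: measurable_bilinear.
pose F i x := (capped_inv c (\sum_j g i j * tnth x j))%:E.
have mcap : measurable_fun [set: R] (fun y => (capped_inv c y)%:E).
  by apply/measurable_EFinP; exact: measurable_capped_inv.
have cap0 y : (0 <= (capped_inv c y)%:E)%E by rewrite lee_fin capped_inv_ge0.
have mF i : measurable_fun [set: q.-tuple R] (F i).
  exact: (measurableT_comp mcap (measurable_lincomb _)).
rewrite /product_measure1.
apply: (@le_trans _ _ (\int[std_gaussian R q]_x \sum_(i < p) ((l i)%:E * F i x))%E).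
  apply: ge0_le_integral => //.
  - exact: measurable_fun_xsection.
  - apply: emeasurable_sum => i; exact: measurable_funeM.
  - move=> x _ /=.
    have -> : xsection S x = [set y | `|\sum_i a x i * tnth y i| < e].
      by apply/seteqP; split=> y; rewrite /xsection/= inE.
    rewrite std_gaussian_lincomb_abs_lt.
    set w := Num.sqrt _; set V := [set y | _].
    have mV : measurable V by apply: measurable_abs_lt; apply: measurable_funM.
    have fV : N01 V \is a fin_num by exact: fin_num_measure.
    have w0 : 0 <= w by exact: sqrtr_ge0.
    rewrite -(fineK fV) /F; under eq_bigr do rewrite -EFinM.
    rewrite sumEFin lee_fin; apply: (@le_sum_capped_inv _ _ c _ w) => //.
    + by rewrite -lee_fin fineK// probability_le1.
    + by rewrite -lee_fin EFinM fineK// cE normal_small_ball// ltW.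
    + rewrite sqr_sqrtr; first by apply: eq_bigr => i _; rewrite ha.
      by apply: sumr_ge0 => i _; exact: sqr_ge0.
rewrite ge0_integral_sum//; last 2 first.
- by move=> i; exact: measurable_funeM.
- by move=> i x _; apply: mule_ge0; [rewrite lee_fin|exact: cap0].
have -> : B%:E = (\sum_(i < p) (l i)%:E * B%:E)%E.
  under eq_bigr do rewrite -EFinM.
  by rewrite sumEFin -mulr_suml b1 mul1r.
apply: lee_sum => i _.
rewrite ge0_integralZl_EFin//; last by move=> x _; exact: cap0.
have [->|li] := eqVneq (l i) 0; first by rewrite !mul0e.
rewrite lee_wpmul2l ?lee_fin//.
rewrite /F (ge0_integral_gaussian_lincomb (g i) mcap cap0).
have -> : Num.sqrt (\sum_j g i j ^+ 2) = 1.
  rewrite -[RHS]sqrtr1; congr Num.sqrt.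
  rewrite /g; under eq_bigr do rewrite exprMn exprVn sqr_sqrtr//.
  by rewrite -mulr_suml divff.
under eq_integral do rewrite mul1r.
exact: integral_capped_inv_le.
Qed.

Lemma independent_joint_law d (T : measurableType d) (P : probability T R)
    d1 d2 (T1 : measurableType d1) (T2 : measurableType d2)
    (X : {RV P >-> T1}) (Y : {RV P >-> T2})
    (m1 : probability T1 R) (m2 : probability T2 R) :
  (forall B, measurable B -> distribution P X B = m1 B) ->
  (forall B, measurable B -> distribution P Y B = m2 B) ->
  independent_RVs P X Y -> forall S, measurable S ->
  P [set w | S (X w, Y w)] = (m1 \x m2)%E S.
Proof.
move=> hX hY ind S mS.
have mZ : measurable_fun [set: T] (fun w => (X w, Y w)).
  by apply/measurable_fun_pairP; split; exact: measurable_funP.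
pose Z : {mfun T >-> (T1 * T2)%type} := HB.pack (fun w => (X w, Y w))
  (isMeasurableFun.Build _ _ _ _ _ mZ).
rewrite (product_measure_unique (m' := distribution P Z))// => U V mU mV.
transitivity (distribution P X U * distribution P Y V)%E; first exact: ind.
by rewrite hX// hY.
Qed.

End smallball.

(** * Spectral norm *)

Section spectral.
Context {R : realType}.
Notation peak := (normal_peak (1 : R)).

Lemma norm2_ge0 n (u : 'cV[R]_n) : 0 <= norm2 u.
Proof. exact: sqrtr_ge0. Qed.

Lemma sqr_norm2 n (u : 'cV[R]_n) : norm2 u ^+ 2 = \sum_i u i 0 ^+ 2.
Proof. by rewrite sqr_sqrtr// sumr_ge0// => i _; exact: sqr_ge0. Qed.

Lemma norm2_cauchy_schwarz n (u v : 'cV[R]_n) :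
  `|\sum_i u i 0 * v i 0| <= norm2 u * norm2 v.
Proof.
have uv0 : 0 <= norm2 u * norm2 v by exact: mulr_ge0 (norm2_ge0 u) (norm2_ge0 v).
rewrite -ler_sqr ?nnegrE// real_normK ?num_real//.
rewrite exprMn; set C := \sum_i _.
have [v0|v0] := eqVneq (norm2 v) 0.
  suff -> : C = 0 by rewrite expr0n/= mulr_ge0 ?sqr_ge0.
  apply: big1 => i _.
  have /eqP := sqr_norm2 v; rewrite v0 expr0n/= eq_sym psumr_eq0; last first.
    by move=> k _; exact: sqr_ge0.
  move=> /allP/(_ i); rewrite mem_index_enum sqrf_eq0 => /(_ isT)/eqP->.
  by rewrite mulr0.
set U := norm2 u ^+ 2; set V := norm2 v ^+ 2.
have V0 : 0 < V by rewrite exprn_even_gt0.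
have : 0 <= \sum_i (V * u i 0 - C * v i 0) ^+ 2.
  by apply: sumr_ge0 => i _; exact: sqr_ge0.
have -> : \sum_i (V * u i 0 - C * v i 0) ^+ 2 = V * (U * V - C ^+ 2).
  transitivity (\sum_i (V ^+ 2 * u i 0 ^+ 2 - 2 * V * C * (u i 0 * v i 0) +
      C ^+ 2 * v i 0 ^+ 2)); first by apply: eq_bigr => i _; ring.
  rewrite big_split sumrB/= -!mulr_sumr -!sqr_norm2 -/C -/U -/V; ring.
by rewrite pmulr_rge0// subr_ge0.
Qed.

Lemma dot_mulmx m n (A : 'M[R]_(m, n)) (z : 'cV[R]_m) (y : 'cV[R]_n) :
  \sum_j (A^T *m z) j 0 * y j 0 = \sum_i z i 0 * (A *m y) i 0.
Proof.
transitivity ((z^T *m (A *m y)) 0 0).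
  rewrite mulmxA -[A in z^T *m A]trmxK -trmx_mul mxE.
  by apply: eq_bigr => j _; rewrite [in RHS]mxE.
by rewrite mxE; apply: eq_bigr => i _; rewrite mxE.
Qed.

(** An approximate leading singular vector. Take [x] in the unit ball with
    [|A x| > k], and [a = A^T (A x)]: then [|A x| ^ 2 = <a, x> <= |a|], while
    [<a, y> = <A x, A y>] is at most [|A x| |A y|]. The strict
    inequality [k < spectral_norm A] provides [x] without a compactness argument. *)
Lemma spectral_norm_approx m n (A : 'M[R]_(m, n)) (k : R) :
  0 < k -> k < spectral_norm A ->
  exists2 a : 'cV[R]_n, 0 < norm2 a &
    forall y : 'cV[R]_n,
      k * `|\sum_j a j 0 * y j 0| <= norm2 a * norm2 (A *m y).
Proof.
move=> k0 kA.
have [|_ [x /= x1 <-] kz] := sup_gt _ kA.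
  by exists (norm2 (A *m 0)), 0 => //=; rewrite /norm2 big1 ?sqrtr0// => i _;
    rewrite mxE expr0n.
set z := A *m x in kz.
have z0 : 0 < norm2 z := lt_trans k0 kz.
have za : norm2 z ^+ 2 <= norm2 (A^T *m z).
  rewrite sqr_norm2; under eq_bigr do rewrite expr2.
  rewrite -dot_mulmx; apply: le_trans (ler_norm _) _.
  apply: le_trans (norm2_cauchy_schwarz _ _) _.
  by rewrite ler_piMr// norm2_ge0.
exists (A^T *m z) => [|y]; first by rewrite (lt_le_trans _ za)// exprn_gt0.
rewrite dot_mulmx; apply: (@le_trans _ _ (norm2 z * (norm2 z * norm2 (A *m y)))).
  apply: ler_pM => //; [exact: ltW|exact: ltW|exact: norm2_cauchy_schwarz].
by rewrite mulrA -expr2 ler_wpM2r// norm2_ge0.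
Qed.

(** As [pi <= 4], the left-hand side is at most [ln ((1 + 2 * t) ^ 2)]. The
    strictness leaves room for the loss in [spectral_norm_approx]. *)
Lemma ln_pi_slack (t : R) : 0 < t -> ln (1 + pi * t ^+ 2) < 1 + 2 * ln (1 + 2 * t).
Proof.
move=> t0.
have u0 : 0 < 1 + 2 * t by rewrite ltr_pwDl// mulr_ge0// ltW.
apply: (@le_lt_trans _ _ (2 * ln (1 + 2 * t))); last by rewrite ltrDr.
have pi4 : pi <= 4 :> R by have := @pihalf_lt2 R; lra.
rewrite mulr_natl -lnXn// ler_ln ?posrE ?exprn_gt0//; last first.
  by rewrite ltr_pwDl// mulr_ge0 ?pi_ge0 ?sqr_ge0.
have : pi * t ^+ 2 <= 4 * t ^+ 2 by rewrite ler_wpM2r// sqr_ge0.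
nra.
Qed.

(** [normal_peak 1] is [1 / sqrt (2 * pi)]. *)
Lemma small_ball_boundE (e c : R) : 0 < e -> c = 2 * peak * e ->
  peak * c * (3 + ln (1 + 2 / c ^+ 2)) = e / pi * (3 + ln (1 + pi / e ^+ 2)).
Proof.
move=> e0 cE.
have pi0 : 0 < pi :> R := pi_gt0 R.
have peak2 : peak ^+ 2 = (2 * pi)^-1.
  rewrite /normal_peak exprVn expr1n mul1r sqr_sqrtr; last exact: mulrn_wge0 (pi_ge0 R).
  by rewrite -mulr_natl.
(* [field] would unfold [pi] *)
move: (pi : R) pi0 peak2 => P P0 peak2.
have -> : peak * c = e / P.
  rewrite (_ : peak * c = 2 * peak ^+ 2 * e); last by rewrite cE; ring.
  by rewrite peak2; field; rewrite gt_eqF.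
rewrite (_ : 2 / c ^+ 2 = P / e ^+ 2)// cE !exprMn peak2; field.
by rewrite !gt_eqF.
Qed.

End spectral.

(** * Kronecker products *)

Lemma tens_colE (R : realType) (p q : nat) (y : p.-tuple R) (x : q.-tuple R)
    (k : 'I_(p * q)) (o : 'I_1) :
  (col_of_tuple y *t col_of_tuple x) k o =
  tnth y (mxtens_unindex k).1 * tnth x (mxtens_unindex k).2.
Proof. by rewrite !mxE. Qed.

Lemma measurable_norm2_tens (R : realType) (m p q : nat) (A : 'M[R]_(m, p * q))
    (d : measure_display) (T : measurableType d)
    (X : T -> q.-tuple R) (Y : T -> p.-tuple R) :
  measurable_fun [set: T] X -> measurable_fun [set: T] Y ->
  measurable_fun [set: T]
    (fun w => norm2 (A *m (col_of_tuple (Y w) *t col_of_tuple (X w)))).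
Proof.
move=> mX mY; rewrite /norm2.
apply: (measurableT_comp (continuous_measurable_fun (@sqrt_continuous R))).
apply: measurable_sum => i; apply: measurable_funX.
under eq_fun do rewrite mxE.
apply: measurable_sum => k; apply: measurable_funM => //.
under eq_fun do rewrite tens_colE.
by apply: measurable_funM; apply: (measurableT_comp (measurable_tnth _)).
Qed.

Lemma sum_tens (R : realType) (p q : nat) (a : 'I_(p * q) -> R)
    (y : 'I_p -> R) (x : 'I_q -> R) :
  \sum_k a k * (y (mxtens_unindex k).1 * x (mxtens_unindex k).2) =
  \sum_i (\sum_j a (mxtens_index (i, j)) * x j) * y i.
Proof.
under [RHS]eq_bigr do rewrite mulr_suml.
rewrite pair_big (reindex (@mxtens_index p q)); last first.
  exists (@mxtens_unindex p q) => k _; first exact: mxtens_indexK.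
  exact: mxtens_unindexK.
by apply: eq_bigr => -[i j] _; rewrite mxtens_indexK mulrA mulrAC.
Qed.

Theorem theorem2p2 (R : realType) (m nhat ntilde : nat)
    (hm : (1 <= m)%N) (hnhat : (1 <= nhat)%N) (hntilde : (1 <= ntilde)%N)
    (A : 'M[R]_(m, ntilde * nhat))
    (d : measure_display) (T : measurableType d) (P : probability T R)
    (xhat : {RV P >-> nhat.-tuple R}) (xtilde : {RV P >-> ntilde.-tuple R})
    (hxhat : has_std_gaussian_distribution P xhat)
    (hxtilde : has_std_gaussian_distribution P xtilde)
    (hindep : independent_RVs P xhat xtilde)
    (theta : R) (htheta : 1 < theta) :
  ((1 - 2 / pi * (2 + ln (1 + 2 * theta)) * theta^-1)%:E <=
   P [set w | (spectral_norm A <=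
     theta * norm2 (A *m (col_of_tuple (xtilde w) *t col_of_tuple (xhat w))))%R])%E.
Proof.
have theta0 : 0 < theta by rewrite (lt_trans ltr01).
pose L := ln (1 + 2 * theta); rewrite -/L.
have L0 : 0 <= L by rewrite ln_ge0// lerDl mulr_ge0// ltW.
set good := [set w | _].
pose tens w := col_of_tuple (xtilde w) *t col_of_tuple (xhat w).
have mnorm : measurable_fun [set: T] (fun w => theta * norm2 (A *m tens w)).
  apply: measurable_funM => //.
  by apply: measurable_norm2_tens; exact: measurable_funP.
have mgood : measurable good.
  have := mnorm measurableT _ (measurable_itv `[spectral_norm A, +oo[).
  rewrite setTI; congr measurable.
  by apply/seteqP; split => w /=; rewrite in_itv/= andbT.
have [A0|A0] := leP (spectral_norm A) 0.
  rewrite (_ : good = setT) ?probability_setT ?lee_fin; last first.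
    apply/seteqP; split=> // w _; apply: le_trans A0 _.
    by rewrite mulr_ge0 ?norm2_ge0// ltW.
  rewrite lerBlDr lerDl !mulr_ge0 ?invr_ge0 ?pi_ge0 ?(ltW theta0)//.
  exact: addr_ge0.
pose D := 3 + ln (1 + pi * theta ^+ 2).
have D0 : 0 < D.
  rewrite ltr_pwDl// ln_ge0// lerDl mulr_ge0 ?pi_ge0 ?sqr_ge0//.
have DL : D < 2 * (2 + L) by have := ln_pi_slack theta0; rewrite /D /L; lra.
(* the loss in [spectral_norm_approx] that turns the small-ball bound at radius
   [1 / theta] into the bound to be proved *)
pose t := 2 * (2 + L) / D.
have t1 : 1 < t by rewrite ltr_pdivlMr// mul1r.
have t0 : 0 < t by rewrite (lt_trans ltr01).
have k0 : 0 < spectral_norm A / t by rewrite divr_gt0.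
have kA : spectral_norm A / t < spectral_norm A.
  by rewrite ltr_pdivrMr// ltr_pMr.
have [a a0 aA] := spectral_norm_approx k0 kA.
pose b i j := a (mxtens_index (i, j)) 0 / norm2 a.
have b1 : \sum_i \sum_j b i j ^+ 2 = 1.
  transitivity ((\sum_k a k 0 ^+ 2) / norm2 a ^+ 2); last first.
    by rewrite -sqr_norm2 divff// expf_neq0// gt_eqF.
  rewrite mulr_suml pair_big (reindex (@mxtens_index ntilde nhat)); last first.
    exists (@mxtens_unindex ntilde nhat) => k _; first exact: mxtens_indexK.
    exact: mxtens_unindexK.
  by apply: eq_bigr => -[i j] _; rewrite /b exprMn exprVn.
have e0 : 0 < t / theta by rewrite divr_gt0.
have ball := std_gaussian_bilinear_small_ball b1 e0 erefl.
rewrite (small_ball_boundE e0 erefl) in ball.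
pose S := [set z : nhat.-tuple R * ntilde.-tuple R |
  `|\sum_i (\sum_j b i j * tnth z.1 j) * tnth z.2 i| < t / theta].
have mS : measurable S.
  by apply: measurable_abs_lt; exact: measurable_bilinear.
have mZ : measurable [set w | S (xhat w, xtilde w)].
  have mp : measurable_fun [set: T] (fun w => (xhat w, xtilde w)).
    by apply/measurable_fun_pairP; split; exact: measurable_funP.
  by have := mp measurableT _ mS; rewrite setTI.
have badS : ~` good `<=` [set w | S (xhat w, xtilde w)].
  move=> w /= /negP; rewrite -ltNge => bad.
  rewrite /S/=.
  have aE : \sum_i (\sum_j b i j * tnth (xhat w) j) * tnth (xtilde w) i =
      (\sum_k a k 0 * tens w k 0) / norm2 a.
    under [in RHS]eq_bigr do rewrite /tens tens_colE.
    rewrite (sum_tens (fun k => a k 0)) mulr_suml; apply: eq_bigr => i _.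
    rewrite mulrAC; congr (_ * _); rewrite mulr_suml; apply: eq_bigr => j _.
    by rewrite /b mulrAC.
  rewrite aE normrM normfV (gtr0_norm a0) ltr_pdivrMr//.
  rewrite -(ltr_pM2l k0); apply: le_lt_trans (aA _) _.
  have -> : spectral_norm A / t * (t / theta * norm2 a) =
      norm2 a * (spectral_norm A / theta).
    by field; rewrite !gt_eqF.
  by rewrite ltr_pM2l// ltr_pdivlMr// mulrC.
have Pbad : (P (~` good) <=
    (2 / pi * (2 + L) * theta^-1)%:E)%E.
  apply: (@le_trans _ _ (P [set w | S (xhat w, xtilde w)])).
    by apply: le_measure; rewrite ?inE//; exact: measurableC.
  rewrite (independent_joint_law hxhat hxtilde hindep mS).
  apply: le_trans ball _; rewrite lee_fin.
  have -> : 2 / pi * (2 + L) / theta = t / theta / pi * D.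
    move: (@pi R) (@pi_gt0 R) => p p0.
    by rewrite /t; field; rewrite !gt_eqF.
  apply: ler_wpM2l; first by rewrite divr_ge0 ?pi_ge0// ltW.
  rewrite /D lerD2l ler_ln ?posrE; last 2 first.
  - by rewrite ltr_pwDl// divr_ge0 ?pi_ge0 ?sqr_ge0.
  - by rewrite ltr_pwDl// mulr_ge0 ?pi_ge0 ?sqr_ge0.
  rewrite lerD2l ler_wpM2l ?pi_ge0// -exprVn invf_div.
  have r0 : 0 <= theta / t by exact: divr_ge0 (ltW theta0) (ltW t0).
  rewrite ler_sqr ?nnegrE ?(ltW theta0)//.
  by rewrite ler_pdivrMr// ler_peMr ?(ltW t1)// ltW.
have := probability_setC P mgood.
have fg : P good \is a fin_num by exact: fin_num_measure.
move: Pbad => /[swap] ->; rewrite -(fineK fg) -EFinB !lee_fin.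
by lra.
Qed.
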